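(* Let $K$ be a compact Hausdorff space and $A\subseteq C_a(K)$. Then the following are equivalent: (i) $A$ is relatively compact in $C_a(K)$; (ii) $A$ is relatively countably compact in $C_a(K)$; (iii) $A$ is relatively sequentially compact in $C_a(K)$.
   Context: $C_a(K)$ is the set $C(K)$ of continuous functions $f:K\to\mathbb R$ equipped with the topology having as basis the sets $\{g: g(x)<f(x)+\epsilon\ \forall x\in F\}$, for $f\in C(K)$, $\epsilon>0$ and finite $F\subseteq K$. Equivalently, a net $(f_\alpha)$ converges to $f$ iff $\limsup_\alpha f_\alpha(x)\le f(x)$ for all $x\in K$. Topological spaces are not assumed Hausdorff. A subset $A$ of a topological space $X$ is relatively compact (resp. relatively countably compact) in $X$ if every open cover (resp. countable open cover) of $X$ has a finite subfamily covering $A$; it is relatively sequentially compact in $X$ if every sequence in $A$ has a subsequence converging to a point of $X$. *)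

(* Defs.v *)
From HB Require Import structures.
From mathcomp Require Import all_boot all_order all_algebra finmap.
From mathcomp Require Import all_classical all_reals all_analysis.

Set Implicit Arguments.
Unset Strict Implicit.
Unset Printing Implicit Defensive.

Import Order.TTheory GRing.Theory Num.Theory.
Import numFieldNormedType.Exports.

Local Open Scope classical_set_scope.
Local Open Scope ring_scope.

Section relative_compactness.
Context {X : topologicalType}.

(* As [cover_compact], except that the families cover the whole space X;
   no closure of A is involved since X need not be Hausdorff. *)
Definition relatively_compact (A : set X) :=
  forall (I : choiceType) (D : set I) (f : I -> set X),
    (forall i, D i -> open (f i)) -> [set: X] `<=` cover D f ->
    finite_subset_cover D f A.

Definition relatively_countably_compact (A : set X) :=
  forall (I : choiceType) (D : set I) (f : I -> set X), countable D ->
    (forall i, D i -> open (f i)) -> [set: X] `<=` cover D f ->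
    finite_subset_cover D f A.

Definition relatively_sequentially_compact (A : set X) :=
  forall u : nat -> X, (forall n, A (u n)) ->
    exists x : X, exists2 phi : nat -> nat,
      increasing_seq phi & u \o phi @ \oo --> x.

End relative_compactness.

(* An alias of [continuousType], so as not to inherit the topologies that the
   library attaches to the latter. *)
Definition Ca (R : realType) (K : topologicalType) : Type := continuousType K R.

HB.instance Definition _ (R : realType) (K : topologicalType) :=
  gen_eqMixin (Ca R K).
HB.instance Definition _ (R : realType) (K : topologicalType) :=
  gen_choiceMixin (Ca R K).

Section Ca_topology.
Context (R : realType) (K : topologicalType).
Implicit Types (f g h : Ca R K) (e : R) (F : set K).

Definition Ca_basic f e F : set (Ca R K) :=
  [set g | forall x, F x -> g x < f x + e].

Definition Ca_base : set (set (Ca R K)) :=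
  [set U | exists f e F, [/\ 0 < e, finite_set F & U = Ca_basic f e F]].

Lemma Ca_basic_self f e F : 0 < e -> Ca_basic f e F f.
Proof. by move=> e0 x _; rewrite ltrDl. Qed.

Lemma near_Ca_basic f e F h : finite_set F -> Ca_basic f e F h ->
  \forall r \near 0^'+, forall x, F x -> h x + r <= f x + e.
Proof.
move=> /finite_fsetP[F' ->] hF.
have : \forall r \near 0^'+,
    (\bigcap_(x in [set` F']) [set r | h x + r <= f x + e]) r.
  apply: filter_bigI => x xF.
  have d0 : 0 < f x + e - h x by rewrite subr_gt0; exact: hF.
  near=> r; rewrite /= addrC -lerBrDr; near: r.
  exact: nbhs_right_le.
by apply: filterS => r rF x xF; exact: rF.
Unshelve. all: by end_near. Qed.

Lemma Ca_base_cover : \bigcup_(U in Ca_base) U = setT.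
Proof.
apply/seteqP; split=> // f _; exists (Ca_basic f 1 set0).
  by exists f, 1, set0; split.
exact: Ca_basic_self.
Qed.

Lemma Ca_base_join (U V : set (Ca R K)) h : Ca_base U -> Ca_base V ->
  U h -> V h -> exists W, [/\ Ca_base W, W h & W `<=` U `&` V].
Proof.
move=> [f [d [F [_ finF ->]]]] [g [e [G [_ finG ->]]]] hF hG.
near (0 : R)^'+ => r.
have r0 : 0 < r by [].
exists (Ca_basic h r (F `|` G)); split; last 1 first.
- move=> k hk; split=> x xF; apply: (lt_le_trans (hk x _)).
  + by left.
  + by move: x xF; near: r; exact: near_Ca_basic.
  + by right.
  + by move: x xF; near: r; exact: near_Ca_basic.
- by exists h, r, (F `|` G); split => //; rewrite finite_setU.
- exact: Ca_basic_self.
Unshelve. all: by end_near. Qed.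

HB.instance Definition _ :=
  @isBaseTopological.Build (Ca R K) (set (Ca R K)) Ca_base id
    Ca_base_cover Ca_base_join.

Lemma open_CaE : @open (Ca R K) =
  [set \bigcup_(U in D) U | D in [set D | D `<=` Ca_base]].
Proof. by []. Qed.

Lemma nbhs_CaE f : nbhs f =
  [set U | exists e F, [/\ 0 < e, finite_set F & Ca_basic f e F `<=` U]].
Proof.
apply/seteqP; split=> U.
- rewrite nbhsE => -[_ [[D DB <-] [W DW Wf]] sU].
  have [g [e [F [_ finF WE]]]] := DB _ DW.
  have gf : Ca_basic g e F f by rewrite -WE.
  near (0 : R)^'+ => r.
  exists r, F; split=> // k fk; apply: sU; exists W => //; rewrite WE => x xF.
  apply: (lt_le_trans (fk x xF)).
  by move: x xF; near: r; exact: near_Ca_basic.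
- move=> [e [F [e0 finF sU]]]; rewrite nbhsE; exists (Ca_basic f e F) => //.
  split; last exact: Ca_basic_self.
  rewrite open_CaE; exists [set Ca_basic f e F]; last by rewrite bigcup_set1.
  by move=> _ ->; exists f, e, F.
Unshelve. all: by end_near. Qed.

(* Convergence to f means that the limsup is at most f x at every point x. *)
Lemma cvg_CaP (Fl : set_system (Ca R K)) f : Filter Fl ->
  Fl --> f <-> forall x e, 0 < e -> \forall g \near Fl, (g : Ca R K) x < f x + e.
Proof.
move=> FFl; split=> [Flf x e e0|H U].
  apply: Flf; rewrite nbhs_CaE; exists e, [set x]; split=> // g; exact.
rewrite nbhs_CaE => -[e [F [e0 /finite_fsetP[F' ->] sU]]].
apply: (filterS sU).
have : Fl (\bigcap_(x in [set` F']) [set g : Ca R K | g x < f x + e]).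
  by apply: filter_bigI => x xF; exact: H.
by apply: filterS => g gF x xF; exact: gF.
Qed.

End Ca_topology.

(* Main.v *)
Require Import Defs.
From HB Require Import structures.
From mathcomp Require Import all_boot all_order all_algebra finmap.
From mathcomp Require Import all_classical all_reals all_analysis.

Import Order.TTheory GRing.Theory Num.Theory.
Import numFieldNormedType.Exports.

Local Open Scope classical_set_scope.
Local Open Scope ring_scope.

(** A filter converges to f in C_a(K) as soon as it is eventually below f + e at
    each point. So a function above a limit is again a limit, and since a
    continuous function on the compact space K is bounded, a filter converges
    to some point of C_a(K) if and only if it converges to some constant: what
    matters is a bound, uniform over K, on pointwise upper limits.

    All three conditions are therefore equivalent to the following one, called
    [no_escape]: there is no sequence of points x_0, x_1, ... of K such that for
    every n some member of A exceeds j at x_j for all j <= n.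

    - Either weak form of compactness implies it. Given (x_j), the open sets
      {g | g x_j < j} cover C_a(K), because each g is bounded; a finite subcover
      of A bounds how long a member of A can escape. And if f_n in A exceeds j at
      x_j for all j <= n, then every limit of a subsequence of (f_n) is at least
      j at x_j for all j, hence unbounded.

    - Conversely, under [no_escape] every filter on A becomes convergent after
      being restricted to a suitable set ([no_escape_cvg]). Otherwise, whatever
      restriction has been made and whatever n is, there is a point at which the
      upper limit is above n, and one can restrict further to the functions
      exceeding n at that point; doing this for n = 0, 1, ... produces a
      sequence of points along which A escapes. For the filter of a sequence,
      restricting means extracting a subsequence, which gives relative
      sequential compactness. For the filter generated by the complements in A
      of the members of a cover without finite subcover, the limit lies in a
      member of the cover whose complement belongs to the filter, which is
      absurd. *)

Lemma near_notin_finite (F : set nat) :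
  finite_set F -> \forall n \near \oo, ~ F n.
Proof.
move=> /finite_fsetP[F' ->].
have : \oo (\bigcap_(m in [set` F']) [set n | m < n]%N).
  by apply: filter_bigI => m _; exact: nbhs_infty_gt.
by apply: filterS => n nF nF'; have := nF n nF'; rewrite /= ltnn.
Qed.

Lemma increasing_seq_geq_id (phi : nat -> nat) :
  increasing_seq phi -> forall n, (n <= phi n)%N.
Proof.
move=> /increasing_seqP phiS; elim=> // n ih.
by apply: leq_ltn_trans ih _; have := phiS n; rewrite ltEnat.
Qed.

Section no_escape.
Context {R : realType} {K : topologicalType}.
Implicit Types (A : set (Ca R K)) (f g : Ca R K).

Definition no_escape A := forall x : nat -> K,
  exists n, forall f, A f -> exists2 j, (j <= n)%N & f (x j) <= j%:R.

(** The heart of the proof. Here ~ F (~` S) says that S is frequent, i.e. meets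
    every element of F, and the last clause that the upper limit of u x along
    the trace of F on S is at most n, with the same n for all x. If no such n
    and S existed, every frequent S could be shrunk to a frequent set where u
    exceeds n at some point, for n = 0, 1, ...; frequent sets meet u @^-1` A, so
    the points thus chosen would contradict [no_escape]. *)
Lemma no_escape_frequently A {T : Type} (F : set_system T) (u : T -> Ca R K) :
  ProperFilter F -> no_escape A -> F (u @^-1` A) ->
  exists n : nat, exists2 S, ~ F (~` S) &
    forall x, F (~` (S `&` [set t | n%:R < u t x])).
Proof.
move=> FF tameA FA; apply: contrapT => nbound.
have step n S : ~ F (~` S) ->
    exists x, ~ F (~` (S `&` [set t | n%:R < u t x])).
  move=> FS; apply: contrapT => /forallNP nx; apply: nbound.
  by exists n, S => // x; exact: contrapT (nx x).
pose frequent S := ~ F (~` S).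
(* A state is a frequent set with the number of restrictions made so far. *)
pose st : Type := ({S | frequent S} * nat)%type.
pose next (p q : st) := q.2 = p.2.+1 /\
  exists x, sval q.1 = sval p.1 `&` [set t | p.2%:R < u t x].
have next_ex p : {q | next p q}.
  apply: cid; case: p => -[S FS] n; have [x FSx] := step n S FS.
  by exists (exist frequent _ FSx, n.+1); split=> //; exists x.
have FT : frequent setT by rewrite /frequent setCT; exact: filter_not_empty.
have [s [s0 sS]] := dependent_choice next_ex (exist frequent _ FT, 0%N).
have s2 n : (s n).2 = n by elim: n => [|n ih]; rewrite ?s0// (sS n).1 ih.
have /choice[x sx] n : exists x : K,
    sval (s n.+1).1 = sval (s n).1 `&` [set t | n%:R < u t x].
  by have [_] := sS n; rewrite s2.
have s_gt n t : sval (s n).1 t -> forall j, (j < n)%N -> j%:R < u t (x j).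
  elim: n => // n ih; rewrite sx => -[/ih snt unt] j.
  by rewrite ltnS leq_eqVlt => /predU1P[->//|]; exact: snt.
have [n nA] := tameA x.
case: (svalP (s n.+1).1); apply: filterS FA => t /nA[j jn ujt] /s_gt.
by move=> /(_ j); rewrite ltnS => /(_ jn); rewrite ltNge ujt.
Qed.

(** The common source of both compactness properties: restricting to a single
    frequent set is enough to make a filter on A converge. *)
Lemma no_escape_cvg A {T : Type} (F : set_system T) (u : T -> Ca R K) :
  ProperFilter F -> no_escape A -> F (u @^-1` A) ->
  exists2 S, ~ F (~` S) & exists g, u @ within S F --> g.
Proof.
move=> FF tameA /(no_escape_frequently _ _ _ _)[//|n [S FS Fbound]].
exists S => //; exists (cst n%:R : continuousType K R).
apply/cvg_CaP => x e e0; apply: filterS (Fbound x) => t /= ntx St.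
rewrite ltNge; apply/negP => le_u; apply: ntx; split=> //.
by apply: lt_le_trans le_u; rewrite ltrDl.
Qed.

Lemma no_escape_relatively_compact A : no_escape A -> relatively_compact A.
Proof.
move=> tameA I D f fopen fcover; apply: contrapT => nfin.
(* D is nonempty, so that A itself belongs to the filter F below. *)
have [i0 Di0 _] := fcover (cst 0 : continuousType K R) Logic.I.
have finIf : finI D (fun i => A `\` f i).
  move=> D' D'D; apply: contrapT => empty; apply: nfin; exists D' => // g Ag.
  apply: contrapT => ng; apply: empty; exists g => i D'i; split=> // fig.
  by apply: ng; exists i.
set F := filter_from (finI_from D (fun i => A `\` f i)) id.
have FF : ProperFilter F := finI_filter finIf.
have Ff i : D i -> F (A `\` f i).
  by move=> Di; exists (A `\` f i) => //; exact: finI_from1.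
have FA : F (id @^-1` A) by apply: filterS (Ff _ Di0) => g [].
have [S FS [g /= Sg]] := no_escape_cvg _ _ _ FF tameA FA.
have [i Di fig] := fcover g Logic.I; apply: FS.
have /Sg Sfi : nbhs g (f i) by apply: open_nbhs_nbhs; split=> //; exact: fopen.
by apply: filterS2 (Ff _ Di) Sfi => h [_ nfih] fih /fih.
Qed.

(** A frequent set for the filter \oo is an infinite set of integers, which is
    enumerated by the required extraction. *)
Lemma no_escape_relatively_sequentially_compact A :
  no_escape A -> relatively_sequentially_compact A.
Proof.
move=> tameA u uA.
have uAoo : \oo (u @^-1` A) by exists 0%N => // n _; exact: uA.
have [S Soo [g Sg]] := no_escape_cvg A \oo u _ tameA uAoo.
have [|phi [phiI _ Sphi]] := @infinite_increasing_seq _ nat S _ 0%N.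
  move=> m /near_notin_finite finS; apply: Soo.
  apply: filterS2 (nbhs_infty_gt m) finS => n /= mn nS Sn.
  by apply: nS; rewrite ltEnat.
exists g, phi => // U /Sg [N _ NU].
exists N => // n /= Nn; apply: NU => //=.
exact: leq_trans Nn (increasing_seq_geq_id _ phiI n).
Qed.

Lemma Ca_ubound g : compact [set: K] -> exists n : nat, forall x, g x < n%:R.
Proof.
move=> compactK.
have /compact_bounded[M [_ bM]] : compact (g @` setT).
  apply: continuous_compact compactK.
  by apply: continuous_subspaceT; exact: cts_fun.
have [n Mn] : exists n : nat, M + 1 < n%:R.
  by exists (Num.truncn (M + 1)).+1; exact: truncnS_gt.
exists n => x; apply: le_lt_trans Mn; apply: le_trans (ler_norm _) _.
by apply: (bM (M + 1)); [rewrite ltrDl|exists x].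
Qed.

Lemma Ca_pt_open (x : K) (r : R) : @open (Ca R K) [set g | g x < r].
Proof.
rewrite openE => g /= gr; rewrite /interior nbhs_CaE.
exists (r - g x), [set x]; split; [by rewrite subr_gt0|exact: finite_set1|].
by move=> h /(_ x erefl); rewrite subrKC.
Qed.

Lemma relatively_countably_compact_no_escape A :
  compact [set: K] -> relatively_countably_compact A -> no_escape A.
Proof.
move=> compactK cA x.
have [| | |D _ AD] := cA nat setT (fun j => [set g | g (x j) < j%:R]).
- exact: countableP.
- by move=> j _; exact: Ca_pt_open.
- by move=> g _; have [j gj] := Ca_ubound g compactK; exists j => //=.
exists (\max_(j <- D) j)%N => f /AD[j /= jD fj].
by exists j; [exact: leq_bigmax_seq|exact: ltW].
Qed.

Lemma relatively_sequentially_compact_no_escape A :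
  compact [set: K] -> relatively_sequentially_compact A -> no_escape A.
Proof.
move=> compactK sA x; apply: contrapT => /forallNP esc.
have /choice[u uP] n : exists f,
    A f /\ forall j, (j <= n)%N -> j%:R < f (x j).
  apply: contrapT => /forallNP nu.
  apply: (esc n) => f Af; apply: contrapT => nf; apply: (nu f); split=> // j jn.
  by rewrite ltNge; apply/negP => fj; apply: nf; exists j.
have [g [phi phiI ug]] := sA u (fun n => (uP n).1).
have [j gj] := Ca_ubound g compactK.
have /(_ _ (x j) (j%:R - g (x j))) := (cvg_CaP _ _).1 ug.
rewrite subr_gt0 subrKC => /(_ (gj _)) ugj.
have [n [/= jn]] : exists n, (j <= n)%N /\ u (phi n) (x j) < j%:R.
  exact: filter_ex (filterI (nbhs_infty_ge j) ugj).
rewrite ltNge => /negP; apply; apply: ltW; apply: (uP _).2.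
exact: leq_trans jn (increasing_seq_geq_id _ phiI n).
Qed.

End no_escape.

Theorem corollary5p8 (R : realType) (K : topologicalType)
    (compactK : compact [set: K]) (hausdorffK : hausdorff_space K)
    (A : set (Ca R K)) :
  [<-> relatively_compact A;
       relatively_countably_compact A;
       relatively_sequentially_compact A].
Proof.
tfae.
- by move=> cA I D f _; exact: cA.
- move=> /(relatively_countably_compact_no_escape _ compactK).
  exact: no_escape_relatively_sequentially_compact.
- move=> /(relatively_sequentially_compact_no_escape _ compactK).
  exact: no_escape_relatively_compact.
Qed.
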